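(* Let $p$ be a prime, $m$ a positive integer, and let $f\in\mathbb{F}_{p^m}[x]$ be a quadratic polynomial (viewed as a function $\mathbb{F}_{p^m}\to\mathbb{F}_{p^m}$). Then for every $c\in\mathbb{F}_p\setminus\{1\}$ the following hold. (i) If $f$ is 2-to-1, then $f$ is APcN. Moreover, if $f$ is a Dembowski–Ostrom (DO) polynomial, then $f$ is APcN if and only if $f$ is planar. (ii) $f$ is a permutation polynomial of $\mathbb{F}_{p^m}$ if and only if $f$ is PcN.
   Context: For $f:\mathbb{F}_{p^n}\to\mathbb{F}_{p^n}$, $c\in\mathbb{F}_{p^n}$ and $a,b\in\mathbb{F}_{p^n}$, let ${}_c\Delta_f(a,b)=\#\{x\in\mathbb{F}_{p^n}: f(x+a)-cf(x)=b\}$, and ${}_c\Delta_f=\max\{{}_c\Delta_f(a,b): a,b\in\mathbb{F}_{p^n},\ (a,c)\neq(0,1)\}$ (the $c$-differential uniformity). $f$ is PcN if ${}_c\Delta_f\le 1$ and APcN if ${}_c\Delta_f\le 2$. $f$ is planar if $x\mapsto f(x+a)-f(x)$ is a permutation for every $a\neq 0$. A linear polynomial is one of the form $\sum_i a_ix^{p^i}$; an affine polynomial differs from a linear one by a constant. A DO polynomial is one of the form $\sum_{0\le i\le j<n}a_{ij}x^{p^i+p^j}$ (with $i<j$ if $p=2$); a quadratic polynomial is one that differs from a DO polynomial by an affine polynomial. A map on $\mathbb{F}_{q}$ is 2-to-1 if: for $q$ even, every $b\in\mathbb{F}_q$ has either 0 or 2 preimages; for $q$ odd, all but one $b\in\mathbb{F}_q$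 have 0 or 2 preimages and the exceptional element has exactly one preimage.
   Formalization: The ''Moreover'' of (i) is stated only for odd p: for p = 2 no function is planar, and the equivalence fails (p = 2, c = 0, f = x^3 on F_8 is DO and a permutation, hence APcN, but not planar). *)

(* Defs.v *)
From HB Require Import structures.
From mathcomp Require Import all_boot all_order all_algebra.

Set Implicit Arguments.
Unset Strict Implicit.
Unset Printing Implicit Defensive.

Import GRing.Theory.
Local Open Scope ring_scope.

Section Functions.

Variable F : finFieldType.
Implicit Types (f : F -> F) (a b c : F).

Definition cDelta f c a b : nat := #|[set x | f (x + a) - c * f x == b]|.

Definition cdiff_uniformity f c : nat :=
  \max_(ab : F * F | (ab.1, c) != (0, 1)) cDelta f c ab.1 ab.2.

Definition PcN f c : Prop := (cdiff_uniformity f c <= 1)%N.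

Definition APcN f c : Prop := (cdiff_uniformity f c <= 2)%N.

(* No function is planar in characteristic 2: f (x + a) - f x takes the same *)
(* value at x and at x + a.                                                   *)
Definition planar f : Prop :=
  forall a, a != 0 -> bijective (fun x => f (x + a) - f x).

Definition num_preim f b : nat := #|[set x | f x == b]|.

Definition two_to_one f : Prop :=
  if odd #|F| then
    exists b0, num_preim f b0 = 1%N /\
      forall b, b != b0 -> num_preim f b = 0%N \/ num_preim f b = 2%N
  else forall b, num_preim f b = 0%N \/ num_preim f b = 2%N.

End Functions.

(* The copy of 'F_p inside a field F of characteristic p: the residue class  *)
(* of k is sent to k%:R.                                                      *)
Definition prime_subfield (p : nat) (F : finFieldType) : {set F} :=
  [set (nat_of_ord k)%:R | k : 'F_p].

(* Meant for #|F| = p ^ n.                                                   *)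
Section Polynomials.

Variables (p n : nat) (F : finFieldType).
Implicit Type f : {poly F}.

Definition linear_poly f : Prop :=
  exists (k : nat) (a : 'I_k -> F), f = \sum_(i < k) a i *: 'X^(p ^ i).

Definition affine_poly f : Prop :=
  exists (l : {poly F}) (d : F), linear_poly l /\ f = l + d%:P.

Definition DO_poly f : Prop :=
  exists a : 'I_n -> 'I_n -> F,
    f = \sum_(i < n) \sum_(j < n | if p == 2%N then (i < j)%N else (i <= j)%N)
          a i j *: 'X^(p ^ i + p ^ j).

Definition quadratic_poly f : Prop :=
  exists g h : {poly F}, [/\ DO_poly g, affine_poly h & f = g + h].

End Polynomials.

(* Main.v *)
Require Import Defs.
From HB Require Import structures.
From mathcomp Require Import all_boot all_order all_algebra.
From mathcomp Require Import finfield ring.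

(* Write [f (x + y) = f x + f y - f 0 + B x y] with [B] biadditive.  Since     *)
(* [1 - c] lies in the prime field, [B x a = (1 - c) B x (a / (1 - c))], so    *)
(* [f (x + a) - c f x] equals [(1 - c) f (x + a / (1 - c))] up to a constant:  *)
(* the numbers [cDelta f c a b] are exactly the fibre sizes of [f].  If [f] is *)
(* DO and [p] is odd, then [f] is even, and both planarity and having fibres   *)
(* of size at most 2 mean that [f x = f y] only for [x = y] or [x = - y].      *)

Set Implicit Arguments.
Unset Strict Implicit.
Unset Printing Implicit Defensive.

Import GRing.Theory.
Local Open Scope ring_scope.

(** Only the biadditivity of the polar form of [f] is used for the fibre comparison, so polynomials
    are turned into maps at once ([quadratic_poly_map]). By [cdiff_uniformity_fibre], PcN and APcN
    then say that the fibres of [f] have at most one or two points, whatever [c] is; this settles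
    the permutation and 2-to-1 claims. For DO polynomials, [even_fibre_le2] and [planar_even] meet
    in one condition on pairs with [f x = f y]. That part needs odd [p]: over a field with [2 ^ n]
    elements, [n > 1] odd, the cube map is a DO permutation, hence PcN for [c = 0], but it is not
    planar. *)

Section Polarization.

Variable F : finFieldType.
Implicit Types (f g : F -> F) (a b c x y z : F).

(** The term [f 0] makes the form vanish when an argument is zero, even if [f] has a constant
    term. *)
Definition polar f x y : F := f (x + y) - f x - f y + f 0.

(** Additivity in one argument suffices, since [polar] is symmetric. *)
Definition quadratic_map f : Prop :=
  forall z, {morph polar f ^~ z : x y / x + y}.

Lemma polarC f x y : polar f x y = polar f y x.
Proof. by rewrite /polar [y + x]addrC; ring. Qed.

Lemma polarE f x y : f (x + y) = polar f x y + f x + f y - f 0.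
Proof. by rewrite /polar; ring. Qed.

Lemma eq_quadratic_map f g : f =1 g -> quadratic_map f -> quadratic_map g.
Proof. by move=> fg qf z x y; have := qf z x y; rewrite /polar /= !fg. Qed.

Lemma quadratic_mapD f g :
  quadratic_map f -> quadratic_map g -> quadratic_map (fun x => f x + g x).
Proof.
move=> qf qg z x y.
have polarD u v : polar (fun x => f x + g x) u v = polar f u v + polar g u v.
  by rewrite /polar; ring.
by rewrite /= !polarD qf qg; ring.
Qed.

Lemma quadratic_mapZ a f : quadratic_map f -> quadratic_map (fun x => a * f x).
Proof.
move=> qf z x y.
have polarZ u v : polar (fun x => a * f x) u v = a * polar f u v.
  by rewrite /polar; ring.
by rewrite /= !polarZ qf mulrDr.
Qed.

Lemma quadratic_map_const a : quadratic_map (fun=> a).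
Proof. by move=> z x y; rewrite /polar; ring. Qed.

Lemma quadratic_map_sum (I : Type) (r : seq I) (P : pred I) (h : I -> F -> F) :
  (forall i, P i -> quadratic_map (h i)) ->
  quadratic_map (fun x => \sum_(i <- r | P i) h i x).
Proof.
move=> qh; elim: r => [|i r IHr].
  by apply: eq_quadratic_map (quadratic_map_const 0) => x; rewrite big_nil.
case Pi: (P i).
  apply: eq_quadratic_map (quadratic_mapD (qh i Pi) IHr) => x.
  by rewrite big_cons Pi.
by apply: eq_quadratic_map IHr => x; rewrite big_cons Pi.
Qed.

Lemma quadratic_map_additive f : {morph f : x y / x + y} -> quadratic_map f.
Proof.
move=> fD z x y.
have polar0 u v : polar f u v = f 0 by rewrite /polar fD; ring.
by rewrite /= !polar0 -fD addr0.
Qed.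

(** The polar form is [f x * g y + f y * g x], visibly biadditive. *)
Lemma quadratic_map_mul f g : {morph f : x y / x + y} ->
  {morph g : x y / x + y} -> quadratic_map (fun x => f x * g x).
Proof.
move=> fD gD.
have f0 : f 0 = 0 by apply: (addIr (f 0)); rewrite -fD !add0r.
by move=> z x y; rewrite /polar !(fD, gD) f0; ring.
Qed.

Section QuadraticMap.

Variable f : F -> F.
Hypothesis qf : quadratic_map f.

Lemma polar0l z : polar f 0 z = 0.
Proof. by rewrite /polar add0r; ring. Qed.

Lemma polarNl x z : polar f (- x) z = - polar f x z.
Proof. by apply/eqP; rewrite -addr_eq0 -qf addNr polar0l. Qed.

(** Additive maps are linear over the prime field; this is what makes [c] in the prime field
    matter. *)
Lemma polar_natl (k : nat) x z : polar f (k%:R * x) z = k%:R * polar f x z.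
Proof.
elim: k => [|k IHk]; first by rewrite !mul0r polar0l.
by rewrite -natr1 !mulrDl !mul1r qf IHk.
Qed.

Section PrimeSubfieldScalar.

Variables (k : nat) (c : F).
Hypotheses (c_nat : c = k%:R) (c_neq1 : c != 1).

Let subc_neq0 : 1 - c != 0.
Proof. by rewrite subr_eq0 eq_sym. Qed.

Lemma cdiff_shift a x :
  f (x + a) - c * f x =
    (1 - c) * (f (x + a / (1 - c)) - f (a / (1 - c)) + f 0) + f a - f 0.
Proof.
have [a' ->] : exists a', a = (1 - c) * a'.
  by exists (a / (1 - c)); rewrite mulrC divfK.
rewrite [_ * a' / _]mulrC mulKf //.
have polar_a : polar f x ((1 - c) * a') = (1 - c) * polar f x a'.
  rewrite polarC (polarC _ x a') mulrBl mul1r qf polarNl.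
  by rewrite {1}c_nat polar_natl -c_nat mulrBl mul1r.
by rewrite !(polarE f) polar_a; ring.
Qed.

Lemma cDelta_fibre a b :
  cDelta f c a b =
    num_preim f ((b - f a + f 0) / (1 - c) + f (a / (1 - c)) - f 0).
Proof.
(* The translation by [a / (1 - c)] carries the solution set onto the fibre. *)
rewrite /cDelta /num_preim -[LHS](card_imset _ (addIr (a / (1 - c)))).
congr #|pred_of_set _|; apply/setP => y; rewrite inE.
rewrite -[y](subrK (a / (1 - c))) (mem_imset _ _ (addIr _)) inE.
rewrite cdiff_shift; move: (f (_ + a / _)) (f (a / _)) => v w.
by apply/eqP/eqP => [<-|->]; field.
Qed.

Lemma cdiff_uniformity_fibre (d : nat) :
  (cdiff_uniformity f c <= d)%N <-> (forall b, num_preim f b <= d)%N.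
Proof.
split => [/bigmax_leqP le_d b | le_d].
  (* The direction [a = 0] is admissible because [c != 1], and there the c-difference is just
     [(1 - c) * f x]. *)
  have := le_d (0, (1 - c) * b).
  rewrite xpair_eqE (negPf c_neq1) andbF => /(_ isT) /=.
  rewrite cDelta_fibre mul0r.
  suff -> : ((1 - c) * b - f 0 + f 0) / (1 - c) + f 0 - f 0 = b by [].
  by field.
by apply/bigmax_leqP => -[a b] _ /=; rewrite cDelta_fibre.
Qed.

End PrimeSubfieldScalar.

End QuadraticMap.

Lemma bijective_fibre f : bijective f <-> (forall b, num_preim f b <= 1)%N.
Proof.
split=> [/bij_inj f_inj b | le1].
  apply/card_le1P => x; rewrite inE => /eqP <- y; rewrite !inE.
  by rewrite (inj_eq f_inj).
apply: injF_bij => x y fxy; have /card_le1_eqP := le1 (f y); apply;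
  by rewrite inE ?fxy.
Qed.

Lemma two_to_one_fibre f b : two_to_one f -> (num_preim f b <= 2)%N.
Proof.
rewrite /two_to_one; case: ifP => _ => [[b0 [f1 f02]] | /(_ b) [] -> //].
by have [->|/f02[] ->] := eqVneq b b0; rewrite ?f1.
Qed.

Section Even.

Variable f : F -> F.
Hypotheses (two_neq0 : 2%:R != 0 :> F) (fN : forall x, f (- x) = f x).

Lemma oppr_neq x : x != 0 -> x != - x.
Proof. by move=> x0; rewrite -subr_eq0 opprK -mulr2n -mulr_natl mulf_neq0. Qed.

(** Fibres of an even map are stable under negation, so a nonzero [x] already accounts for two
    points, and any further [y] makes a third. *)
Lemma even_fibre_le2 :
  (forall b, num_preim f b <= 2)%N <->
  (forall x y, f x = f y -> x = y \/ x = - y).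
Proof.
have fibre3 x y : f x = f y -> x != 0 -> y != x -> y != - x ->
    (2 < num_preim f (f x))%N.
  move=> fxy x0 yx ynx; apply: (@leq_trans #|[set x; - x; y]|).
    rewrite -setUA cardsU1 cards2 !inE (eq_sym (- x)) ynx (eq_sym x y).
    by rewrite (negPf yx) (negPf (oppr_neq x0)).
  apply/subset_leq_card/subsetP => z.
  by rewrite !inE => /orP[/orP[]|] /eqP->; rewrite ?fN ?fxy eqxx.
split=> [le2 x y fxy | eqN b].
  have [|xy] := eqVneq x y; first by left.
  have [|xny] := eqVneq x (- y); first by right.
  (* If [x = 0] then [x] and [- x] coincide, so the three points are built from [y] instead. *)
  have [x0|x0] := eqVneq x 0.
    have y0 : y != 0 by rewrite -x0 eq_sym.
    by have := fibre3 _ _ (esym fxy) y0 xy xny; rewrite ltnNge le2.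
  have yx : y != x by rewrite eq_sym.
  have ynx : y != - x by rewrite eq_sym eqr_oppLR.
  by have := fibre3 _ _ fxy x0 yx ynx; rewrite ltnNge le2.
have [->//|] := posnP (num_preim f b).
case/card_gt0P => x; rewrite inE => /eqP fx.
apply: (@leq_trans #|[set x; - x]|); last by rewrite cards2; case: eqP.
apply/subset_leq_card/subsetP => y; rewrite !inE -fx => /eqP /eqN[] ->.
  by rewrite eqxx.
by rewrite eqxx orbT.
Qed.

(** If [f x = f y], the difference map in direction [x - y] vanishes at both [- x] and [y], so
    planarity forces [y = - x]. Conversely, a collision of the difference map in direction [a] at
    [x] and [y] means [polar f (x - y) a = 0]; by evenness [f] then agrees at [x - y + a] and
    [x - y - a], and equality up to sign gives [a = - a] or [x - y = - (x - y)]. *)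
Lemma planar_even : quadratic_map f -> f 0 = 0 ->
  planar f <-> (forall x y, f x = f y -> x = y \/ x = - y).
Proof.
move=> qf f0; split=> [f_planar x y fxy | eqN a a0].
  have [|xy] := eqVneq x y; [by left | right].
  have /f_planar/bij_inj D_inj : x - y != 0 by rewrite subr_eq0.
  apply/oppr_inj; rewrite opprK; apply: D_inj => /=.
  have -> : - x + (x - y) = - y by ring.
  have -> : y + (x - y) = x by ring.
  by rewrite !fN fxy !subrr.
apply: injF_bij => x y Dxy.
have polar0 : polar f (x - y) a = 0.
  rewrite qf polarNl // /polar.
  by have -> : f (x + a) = f (y + a) - f y + f x; [rewrite -Dxy subrK | ring].
have eqf : f (x - y + a) = f (x - y - a).
  rewrite (polarE f (x - y) a) (polarE f (x - y) (- a)) fN.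
  by rewrite [polar f _ (- a)]polarC polarNl // [polar f a _]polarC polar0 oppr0.
have [/addrI aNa|] := eqN _ _ eqf.
  by have := oppr_neq a0; rewrite -aNa eqxx.
rewrite opprB [a - _]addrC => /addIr xy.
by apply/eqP; rewrite -subr_eq0; apply: contraTT isT => /oppr_neq; rewrite -xy eqxx.
Qed.

End Even.

End Polarization.

Section QuadraticPolynomials.

Variables (p n : nat) (F : finFieldType).
Hypothesis pcharFp : p \in [pchar F].
Implicit Type f : {poly F}.

Lemma expr_pXD i : {morph (fun x : F => x ^+ (p ^ i)) : x y / x + y}.
Proof.
move=> x y; apply: exprDn_pchar; rewrite pnatX.
by rewrite pnatE ?(pcharf_prime pcharFp) // pcharFp.
Qed.

(** Each monomial is a product of two powers of Frobenius, which are additive. *)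
Lemma DO_quadratic_map f : DO_poly p n f -> quadratic_map (horner f).
Proof.
case=> a ->.
apply: (@eq_quadratic_map _ (fun x => \sum_(i < n)
    \sum_(j < n | if p == 2%N then (i < j)%N else (i <= j)%N)
      a i j * (x ^+ (p ^ i) * x ^+ (p ^ j)))) => [x|].
  rewrite horner_sum; apply: eq_bigr => i _; rewrite horner_sum.
  by apply: eq_bigr => j _; rewrite hornerZ hornerXn exprD.
apply: quadratic_map_sum => i _; apply: quadratic_map_sum => j _.
apply: quadratic_mapZ; apply: quadratic_map_mul; exact: expr_pXD.
Qed.

Lemma affine_quadratic_map f : affine_poly p f -> quadratic_map (horner f).
Proof.
case=> _ [d [[k [a ->]] ->]].
apply: (@eq_quadratic_map _ (fun x => \sum_(i < k) a i * x ^+ (p ^ i) + d)).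
  move=> x; rewrite hornerD hornerC horner_sum; congr (_ + _).
  by apply: eq_bigr => i _; rewrite hornerZ hornerXn.
apply: quadratic_mapD (quadratic_map_const d).
apply: quadratic_map_sum => i _; apply: quadratic_mapZ.
exact/quadratic_map_additive/expr_pXD.
Qed.

Lemma quadratic_poly_map f : quadratic_poly p n f -> quadratic_map (horner f).
Proof.
case=> g [h [/DO_quadratic_map qg /affine_quadratic_map qh ->]].
by apply: eq_quadratic_map (quadratic_mapD qg qh) => x; rewrite hornerD.
Qed.

Lemma DO_horner0 f : DO_poly p n f -> f.[0] = 0.
Proof.
case=> a ->; rewrite horner_sum big1 // => i _; rewrite horner_sum big1 // => j _.
rewrite hornerZ hornerXn expr0n addn_eq0 !expn_eq0.
by rewrite (gtn_eqF (prime_gt0 (pcharf_prime pcharFp))) mulr0.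
Qed.

(** For odd [p] every exponent [p ^ i + p ^ j] is even. *)
Lemma DO_hornerN f x : odd p -> DO_poly p n f -> f.[- x] = f.[x].
Proof.
move=> p_odd [a ->]; rewrite !horner_sum; apply: eq_bigr => i _.
rewrite !horner_sum; apply: eq_bigr => j _; rewrite !hornerZ !hornerXn exprNn.
by rewrite -signr_odd oddD !oddX p_odd !orbT mul1r.
Qed.

End QuadraticPolynomials.

Theorem theorem3p1 (p m : nat) (F : finFieldType) (f : {poly F})
    (hp : prime p) (hm : (0 < m)%N) (hF : #|F| = (p ^ m)%N)
    (hf : quadratic_poly p m f) :
  forall c : F, c \in prime_subfield p F -> c != 1 ->
    ((two_to_one (horner f) -> APcN (horner f) c) /\
     (p <> 2%N -> DO_poly p m f ->
        (APcN (horner f) c <-> planar (horner f)))) /\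
    (bijective (horner f) <-> PcN (horner f) c).
Proof.
move=> c /imsetP[k _ ->] k1.
have pcharFp : p \in [pchar F] by apply: card_finPcharP hF hp.
have qf := quadratic_poly_map pcharFp hf.
rewrite /APcN /PcN; split; last first.
  by rewrite (cdiff_uniformity_fibre qf erefl k1) bijective_fibre.
rewrite (cdiff_uniformity_fibre qf erefl k1); split=> [f21 b | p2 f_DO].
  exact: two_to_one_fibre.
have p_odd : odd p by case/even_prime: hp.
have two_neq0 : 2%:R != 0 :> F.
  rewrite -(dvdn_pcharf pcharFp) dvdn_prime2 //; exact/eqP.
have fN x : f.[- x] = f.[x] by apply: DO_hornerN f_DO.
rewrite even_fibre_le2 // planar_even //; exact: DO_horner0 f_DO.
Qed.
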